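(* Let $(X,T)$ be a transitive system. Then the following conditions are equivalent: (1) $(X,T)$ is a van der Waerden system; (2) there exists an $\mathcal{AP}$-transitive point in $X$; (3) every transitive point of $(X,T)$ is an $\mathcal{AP}$-transitive point.
   Context: A (topological) dynamical system $(X,T)$ consists of a (nonempty) compact metric space and a continuous map $T\colon X\to X$. $\mathbb{N}$ is the set of positive integers. $(X,T)$ is transitive if for every two non-empty open $U,V\subset X$ there is $n\in\mathbb{N}$ with $T^nU\cap V\ne\emptyset$. A point $x$ is transitive if its orbit $\{T^nx:n=0,1,2,\dots\}$ is dense in $X$. $(X,T)$ is a van der Waerden system if for every non-empty open $U\subset X$ and every $d\in\mathbb{N}$ there exists $n\in\mathbb{N}$ such that $U\cap T^{-n}U\cap T^{-2n}U\cap\dots\cap T^{-dn}U\ne\emptyset$. A set $F\subset\mathbb{N}$ is an AP-set if for every $d\ge1$ there are $a,n\in\mathbb{N}$ with $\{a,a+n,\dots,a+dn\}\subset F$. A point $x\in X$ is $\mathcal{AP}$-transitive if $N(x,U)=\{n\in\mathbb{N}:T^nx\in U\}$ is an AP-set for every non-empty open set $U\subset X$. *)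

(* Defs.v *)
From HB Require Import structures.
From mathcomp Require Import all_boot all_order all_algebra.
From mathcomp Require Import all_classical all_reals all_analysis.

Set Implicit Arguments.
Unset Strict Implicit.
Unset Printing Implicit Defensive.

Local Open Scope classical_set_scope.

(* The natural numbers of the theory are the positive integers, so every index
   ranging over them carries an explicit [0 < n] over [nat]. *)

Definition dynamical_system (R : realType) (X : metricType R) (T : X -> X) :
    Prop :=
  [/\ [set: X] !=set0, compact [set: X] & continuous T].

Definition transitive_system (R : realType) (X : metricType R) (T : X -> X) :
    Prop :=
  forall U V : set X, open U -> open V -> U !=set0 -> V !=set0 ->
    exists n : nat, (0 < n)%N /\ (iter n T @` U) `&` V !=set0.

Definition orbit_set (X : Type) (T : X -> X) (x : X) : set X :=
  [set iter n T x | n in [set: nat]].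

Definition transitive_point (R : realType) (X : metricType R) (T : X -> X)
    (x : X) : Prop :=
  dense (orbit_set T x).

(* The factor i = 0 of the intersection is U itself. *)
Definition van_der_Waerden_system (R : realType) (X : metricType R)
    (T : X -> X) : Prop :=
  forall U : set X, open U -> U !=set0 ->
  forall d : nat, (0 < d)%N ->
    exists n : nat, (0 < n)%N /\
      \bigcap_(i in [set i | (i <= d)%N]) (iter (i * n) T @^-1` U) !=set0.

Definition AP_set (F : set nat) : Prop :=
  forall d : nat, (1 <= d)%N ->
    exists a n : nat, [/\ (0 < a)%N, (0 < n)%N &
      [set (a + i * n)%N | i in [set i | (i <= d)%N]] `<=` F].

Definition return_times (X : Type) (T : X -> X) (x : X) (U : set X) :
    set nat :=
  [set n | (0 < n)%N /\ U (iter n T x)].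

Definition AP_transitive_point (R : realType) (X : metricType R) (T : X -> X)
    (x : X) : Prop :=
  forall U : set X, open U -> U !=set0 -> AP_set (return_times T x U).

(* Main.v *)
From HB Require Import structures.
Require Import Defs.
From mathcomp Require Import all_boot all_order all_algebra.
From mathcomp Require Import all_classical all_reals all_analysis.

(** Everything rests on reading the van der Waerden set
    [W = \bigcap_(i <= d) T^-(i n) U] as the set of starting points of an
    arithmetic progression of visits to [U]: if [T^a x] lies in [W], then [x]
    visits [U] at the times [a, a + n, ..., a + d n], and conversely.

    - If some [x] is AP-transitive, a progression of visits of [x] to [U] makes
      [T^a x] a point of [W], so the system is van der Waerden
      ([AP_transitive_point_vdW]).
    - If the system is van der Waerden, [W] is open and nonempty for a suitable
      [n], so the orbit of any transitive point meets it, and it does so at a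
      positive time because the system is transitive
      ([transitive_point_visit]); hence every transitive point is
      AP-transitive ([vdW_transitive_point_AP]).
    - It remains that a transitive point exists
      ([transitive_point_exists]). This is the Birkhoff transitivity theorem:
      for each nonempty member [U] of a countable base, the points whose orbit
      meets [U] form a dense open set, and by the Baire property of a compact
      regular space ([compact_regular_Baire]) these countably many sets have a
      common point. *)

Set Implicit Arguments.
Unset Strict Implicit.
Unset Printing Implicit Defensive.

Local Open Scope classical_set_scope.

(** * Baire property of compact regular spaces *)

(** Regularity lets the next open set be chosen with its closure inside the
    current one and inside the next dense set; a cluster point of the resulting
    decreasing sequence lies in all the closures. *)
Lemma compact_regular_Baire (X : topologicalType) (G : nat -> set X) :
  compact [set: X] -> regular_space X ->
  (forall n, open (G n) /\ dense (G n)) -> dense (\bigcap_n G n).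
Proof.
move=> cX rX God V V0 oV.
pose P (O : set X) := open O /\ O !=set0.
have step (p : nat * set X) : exists O' : set X,
    P p.2 -> P O' /\ closure O' `<=` p.2 `&` G p.1.
  have [PO|nPO] := pselect (P p.2); last by exists set0.
  have [oO O0] := PO; have [oG dG] := God p.1.
  have [x [Ox Gx]] := dG _ O0 oO.
  have : nbhs x (p.2 `&` G p.1) by apply: open_nbhs_nbhs; split=> //; exact: openI.
  move=> /rX[C nC CO]; exists C° => _; split.
    by split; [exact: open_interior|exists x].
  by apply: subset_trans CO; apply: closureS; exact: interior_subset.
have [next nextP] := choice step.
pose O := fix O n := if n is m.+1 then next (m, O m) else V.
have PO n : P (O n).
  by elim: n => [//|n IHn]; have [] := nextP (n, O n) IHn.
have OS n : closure (O n.+1) `<=` O n `&` G n.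
  by have [] := nextP (n, O n) (PO n).
have decr m n : (m <= n)%N -> O n `<=` O m.
  elim: n => [|n IHn]; first by rewrite leqn0 => /eqP ->.
  rewrite leq_eqVlt => /predU1P[-> //|/IHn OnOm] y Oy; apply: OnOm.
  by have [] := OS n y (subset_closure Oy).
pose F := filter_from [set: nat] O.
have FF : ProperFilter F.
  apply: filter_from_proper => [|n _]; last exact: (PO n).2.
  apply: filter_from_filter; first by exists 0%N.
  move=> i j _ _; exists (maxn i j) => // y Oy.
  by split; apply: decr Oy; rewrite ?leq_maxl ?leq_maxr.
have [x [_ xF]] : [set: X] `&` cluster F !=set0 by apply: cX; exists 0%N.
have xO n : (O n `&` G n) x.
  by apply: OS => B nB; apply: xF nB; exists n.+1.
by exists x; split=> [|n _]; [have [] := xO 0%N|have [] := xO n].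
Qed.

(** * Existence of transitive points *)

(** Countability of the base is known for pointed spaces, and nonemptiness
    supplies the point. *)
Lemma compact_metric_second_countable (R : realType) (X : metricType R) :
  [set: X] !=set0 -> compact [set: X] -> @second_countable X.
Proof.
move=> [x0 _] cX.
pose X' : pseudoPMetricType R := HB.pack (X : Type) X (isPointed.Build X x0).
exact: (@compact_second_countable R X' cX).
Qed.

Lemma continuous_iter (X : topologicalType) (T : X -> X) n :
  continuous T -> continuous (iter n T).
Proof.
move=> cT; elim: n => [|n IHn] x; first exact: cvg_id.
by apply: (@continuous_comp _ _ _ (iter n T) T); [exact: IHn|exact: cT].
Qed.

Lemma open_preimage_iter (X : topologicalType) (T : X -> X) n (U : set X) :
  continuous T -> open U -> open (iter n T @^-1` U).
Proof.
by move=> cT oU; apply: open_comp => // x _; exact: continuous_iter.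
Qed.

Lemma transitive_point_exists (R : realType) (X : metricType R) (T : X -> X) :
  dynamical_system T -> transitive_system T ->
  exists x : X, transitive_point T x.
Proof.
move=> [X0 cX cT] hT.
have [B cB [Bo Bb]] := compact_metric_second_countable X0 cX.
pose hit (U : set X) : set X := \bigcup_k (iter k T @^-1` U).
have hit_od U : open U -> U !=set0 -> open (hit U) /\ dense (hit U).
  move=> oU U0; split; first by apply: bigcup_open => k _; exact: open_preimage_iter.
  move=> V V0 oV; have [k [_ [_ [[y Vy <-] Uy]]]] := hT V U oV oU V0 U0.
  by exists y; split=> //; exists k.
(* The empty set may belong to the base, but no orbit meets it. *)
pose B' := [set U | B U /\ U !=set0].
have [x xB'] : exists x, forall U, B' U -> hit U x.
  have cB' : countable B' by apply: sub_countable cB; apply: subset_card_le => U [].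
  have [B'0|[g]] : B' = set0 \/ $|{surjfun [set: nat] >-> B'}|.
    exact/pfcard_geP.
    by have [x _] := X0; exists x => U; rewrite B'0.
  have god n : open (hit (g n)) /\ dense (hit (g n)).
    have [Bg g0] : B' (g n) by exact: funS.
    by apply: hit_od => //; exact: Bo.
  have rX : regular_space X by exact: uniform_regular.
  have [x [_ xg]] := compact_regular_Baire cX rX god X0 openT.
  exists x => U B'U; have [n _ <-] := @surj _ _ _ _ g U B'U; exact: xg.
exists x => V [y Vy] oV.
have [U [BU Uy] UV] : filter_from [set U | B U /\ U y] id V.
  by apply: Bb; exact: open_nbhs_nbhs.
have [k _ Uk] : hit U x by apply: xB'; split=> //; exists y.
by exists (iter k T x); split; [exact: UV|exists k].
Qed.

(** * Progressions of visits *)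

(** Density of the orbit may only give a visit at time [0]. By transitivity of
    the system the open set [T^-n W] is nonempty for some [n > 0]; visiting it
    at time [j] means being in [W] at the positive time [n + j]. *)
Lemma transitive_point_visit (R : realType) (X : metricType R) (T : X -> X)
    (x : X) (W : set X) :
  continuous T -> transitive_system T -> transitive_point T x ->
  open W -> W !=set0 -> exists a, (0 < a)%N /\ W (iter a T x).
Proof.
move=> cT hT hx oW W0.
have [n [n0 [_ [[y Wy <-] Wny]]]] := hT W W oW oW W0 W0.
have [|| z [Wz [j _ jz]]] := hx (iter n T @^-1` W).
- by exists y.
- exact: open_preimage_iter.
by exists (n + j)%N; rewrite addn_gt0 n0 iterD jz.
Qed.

Lemma AP_transitive_point_vdW (R : realType) (X : metricType R) (T : X -> X)
    (x : X) : AP_transitive_point T x -> van_der_Waerden_system T.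
Proof.
move=> hx U oU U0 d d0; have [a [n [a0 n0 sub]]] := hx U oU U0 d d0.
exists n; split=> //; exists (iter a T x) => i /= id_.
have [_] : return_times T x U (a + i * n)%N by apply: sub; exists i.
by rewrite addnC iterD.
Qed.

Lemma vdW_transitive_point_AP (R : realType) (X : metricType R) (T : X -> X)
    (x : X) :
  continuous T -> transitive_system T -> van_der_Waerden_system T ->
  transitive_point T x -> AP_transitive_point T x.
Proof.
move=> cT hT hW hx U oU U0 d d0; have [n [n0 W0]] := hW U oU U0 d d0.
have oW : open (\bigcap_(i in [set i | (i <= d)%N]) (iter (i * n) T @^-1` U)).
  rewrite (_ : [set i | (i <= d)%N] = `I_d.+1)//.
  rewrite bigcap_mkord; elim/big_ind: _ => [|A B|i _].
  - exact: openT.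
  - exact: openI.
  - exact: open_preimage_iter.
have [a [a0 Wa]] := transitive_point_visit cT hT hx oW W0.
exists a, n; split=> // _ [i /= id_ <-]; split; first by rewrite addn_gt0 a0.
by rewrite addnC iterD; exact: Wa.
Qed.

Theorem proposition4p14 (R : realType) (X : metricType R) (T : X -> X)
    (hXT : dynamical_system T) (hT : transitive_system T) :
  (van_der_Waerden_system T <-> exists x : X, AP_transitive_point T x) /\
  ((exists x : X, AP_transitive_point T x) <->
   (forall x : X, transitive_point T x -> AP_transitive_point T x)).
Proof.
have [_ _ cT] := hXT; have [x0 x0T] := transitive_point_exists hXT hT.
split; split.
- by move=> hW; exists x0; exact: vdW_transitive_point_AP.
- by move=> [x]; exact: AP_transitive_point_vdW.
- move=> [x xAP] y yT.
  by apply: vdW_transitive_point_AP => //; exact: AP_transitive_point_vdW xAP.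
- by move=> h; exists x0; exact: h.
Qed.
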